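(* Let $A, B \in \mathbb{P}_{2n}(\mathbb{R})$ and let $i,j \in \{1,\ldots,n\}$ be any indices such that $i+j-1 \leq n$. Then the equality $$d_{i+j-1}(A+B) = d_i(A) + d_j(B)$$ holds if and only if there exists a common normalized symplectic eigenvector pair of $A$, $B$, and $A+B$ corresponding to their symplectic eigenvalues $d_i(A)$, $d_j(B)$, and $d_{i+j-1}(A+B)$, respectively; that is, a single pair $(u,v)$ of vectors in $\mathbb{R}^{2n}$ which is a normalized symplectic eigenvector pair of $A$ corresponding to $d_i(A)$, of $B$ corresponding to $d_j(B)$, and of $A+B$ corresponding to $d_{i+j-1}(A+B)$.
   Context: $\mathbb{P}_{2n}(\mathbb{R})$ is the set of $2n\times 2n$ real symmetric positive definite matrices. $J = \begin{pmatrix} 0 & I_n \\ -I_n & 0\end{pmatrix}$, and $\langle\cdot,\cdot\rangle$ is the Euclidean inner product on $\mathbb{R}^{2n}$. $\operatorname{Sp}(2n)$ is the set of real $2n\times 2n$ matrices $M$ with $M^TJM=J$. By Williamson's theorem, for $A\in\mathbb{P}_{2n}(\mathbb{R})$ there is $M\in\operatorname{Sp}(2n)$ such that $M^TAM = D\oplus D$ with $D$ an $n\times n$ diagonal matrix with positive diagonal entries $d_1(A)\le\cdots\le d_n(A)$; these numbers are uniquely determined by $A$ and are called the symplectic eigenvalues of $A$. A pair $(u,v)$ of non-zero vectors in $\mathbb{R}^{2n}$ is a symplectic eigenvector pair of $A$ corresponding to a symplectic eigenvalue $d$ of $A$ if $Au = d\,Jv$ and $Av = -d\,Ju$; it is normalized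 if in addition $\langle u, Jv\rangle = 1$. *)

(* Defs.v *)
From mathcomp Require Import all_boot all_order all_algebra.
From mathcomp Require Import boolp classical_sets reals.

Set Implicit Arguments.
Unset Strict Implicit.
Unset Printing Implicit Defensive.

Import Order.TTheory GRing.Theory Num.Theory.

Local Open Scope ring_scope.
Local Open Scope classical_set_scope.

Definition dotv (R : realType) (m : nat) (x y : 'cV[R]_m) : R :=
  \sum_(k < m) x k 0 * y k 0.

Definition posdefmx (R : realType) (m : nat) (A : 'M[R]_m) : Prop :=
  A^T = A /\ forall x : 'cV[R]_m, x != 0 -> 0 < dotv x (A *m x).

Definition Jmx (R : realType) (n : nat) : 'M[R]_(n + n) :=
  block_mx 0 1%:M (- 1%:M) 0.

Arguments Jmx {R n}.

Definition symplecticmx (R : realType) (n : nat) (M : 'M[R]_(n + n)) : Prop :=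
  M^T *m Jmx *m M = Jmx.

Definition williamson_diag (R : realType) (n : nat) (A : 'M[R]_(n + n))
    (d : 'rV[R]_n) : Prop :=
  [/\ forall k, 0 < d 0 k,
      forall k l : 'I_n, (k <= l)%N -> d 0 k <= d 0 l &
      exists2 M : 'M[R]_(n + n), symplecticmx M &
        M^T *m A *m M = block_mx (diag_mx d) 0 0 (diag_mx d)].

(* [sympl_eigenvalue A k] is the symplectic eigenvalue usually written
   d_{k+1}(A): indices start at 0.  By Williamson's theorem, when A is positive
   definite there is exactly one d with [williamson_diag A d], so [xget] selects
   it; the default value 0 is only relevant when A has no Williamson form. *)
Definition sympl_eigenvalue (R : realType) (n : nat) (A : 'M[R]_(n + n))
    (k : 'I_n) : R :=
  (xget 0 [set d : 'rV[R]_n | williamson_diag A d]) 0 k.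

Definition sympl_eigenpair (R : realType) (n : nat) (A : 'M[R]_(n + n)) (d : R)
    (u v : 'cV[R]_(n + n)) : Prop :=
  [/\ u != 0, v != 0, A *m u = d *: (Jmx *m v) & A *m v = - d *: (Jmx *m u)].

Definition normalized_sympl_eigenpair (R : realType) (n : nat)
    (A : 'M[R]_(n + n)) (d : R) (u v : 'cV[R]_(n + n)) : Prop :=
  sympl_eigenpair A d u v /\ dotv u (Jmx *m v) = 1.

(* Main.v *)
Require Import Defs.
From mathcomp Require Import all_boot all_order all_algebra all_fingroup.
From mathcomp Require Import classical_sets reals.
From mathcomp Require Import complex ring lra zify.

(* For t > 0 consider the quadratic form
     q_{A,t}(u, v) = <u, Au> + <v, Av> - 2 t <u, Jv>,
   the Hermitian form A - t(-iJ) at z = u + iv.  In a Williamson basis it is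
   diagonal with coefficients proportional to d_k(A) - t and d_k(A) + t, so its
   nonzero isotropic vectors in a coordinate subspace where it is nonnegative
   are eigenvector pairs for t.  Since q_{A+B,s+t} = q_{A,s} + q_{B,t},
   a dimension count, with s = d_i(A) and t = d_j(B), yields a nonzero (u, v) at
   which q_{A,s} and q_{B,t} are nonnegative while their sum is nonpositive as
   soon as s + t = d_{i+j-1}(A+B); all three forms then vanish at (u, v). *)

Set Implicit Arguments.
Unset Strict Implicit.
Unset Printing Implicit Defensive.

Import Order.TTheory GRing.Theory Num.Theory.

Local Open Scope ring_scope.

(** * Real form of complex eigenvectors *)

Lemma real_eigenpair (R : rcfType) (r : nat) (T : 'M[R]_r) : (0 < r)%N ->
  exists (a b : 'rV[R]_r) (p q : R),
    [/\ (a != 0) || (b != 0), a *m T = p *: a - q *: b &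
        b *m T = q *: a + p *: b].
Proof.
move=> r_gt0.
(* Over the complex numbers [T] has a left eigenvector [w] with eigenvalue [z]; the witnesses are
   the real and imaginary parts of both. *)
have [z /eigenvalueP[w wT w0]] :=
  eigenvalue_closed (map_mx (real_complex R) T) r_gt0.
exists (map_mx (@complex.Re R) w), (map_mx (@complex.Im R) w),
  (complex.Re z), (complex.Im z); split.
- apply: contra_neqT w0; rewrite negb_or !negbK => /andP[/eqP a0 /eqP b0].
  apply/rowP => k; apply/eqP; rewrite eq_complex.
  move/rowP: a0 => /(_ k); move/rowP: b0 => /(_ k).
  by rewrite !mxE => -> ->; rewrite !eqxx.
- apply/rowP => k; move/rowP: wT => /(_ k) /(congr1 (@complex.Re R)).
  rewrite !mxE (raddf_sum (@complex.Re R : Rcomplex R -> R)) /=.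
  under eq_bigr => l _ do rewrite !mxE.
  move=> e; transitivity (complex.Re (z * w 0 k)).
    rewrite -e; apply: eq_bigr => l _; rewrite !mxE.
    by case: (w 0 l) => ? ? /=; rewrite mulr0 subr0.
  by case: z (w 0 k) {e} => ? ? [].
- apply/rowP => k; move/rowP: wT => /(_ k) /(congr1 (@complex.Im R)).
  rewrite !mxE (raddf_sum (@complex.Im R : Rcomplex R -> R)) /=.
  under eq_bigr => l _ do rewrite !mxE.
  move=> e; transitivity (complex.Im (z * w 0 k)).
    rewrite -e; apply: eq_bigr => l _; rewrite !mxE.
    by case: (w 0 l) => ? ? /=; rewrite mulr0 add0r.
  by case: z (w 0 k) {e} => ? ? [] /= *; rewrite addrC.
Qed.

(** In the basis [row_base W], [T] acts on the row space of [W] by a square matrix [T']; the pair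
    found for [T'] is carried back injectively. *)
Lemma real_eigenpair_stable (R : rcfType) (m N : nat) (W : 'M[R]_(m, N))
    (T : 'M[R]_N) :
  (0 < \rank W)%N -> stablemx W T ->
  exists (a b : 'rV[R]_N) (p q : R),
    [/\ (a != 0) || (b != 0), (a <= W)%MS, (b <= W)%MS,
        a *m T = p *: a - q *: b & b *m T = q *: a + p *: b].
Proof.
move=> rW sW.
pose B := row_base W.
have [T' BT] : exists T', B *m T = T' *m B.
  apply/submxP; rewrite eq_row_base; apply: submx_trans sW.
  by rewrite submxMr // eq_row_base.
have [a [b [p [q [ab aT bT]]]]] := real_eigenpair T' rW.
have inj (x : 'rV_(\rank W)) : (x *m B == 0) = (x == 0).
  apply/eqP/eqP => [|->]; last by rewrite mul0mx.
  by move=> h; apply: (row_free_inj (row_base_free W)); rewrite mul0mx.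
exists (a *m B), (b *m B), p, q; split; rewrite ?inj //.
- by rewrite (submx_trans (submxMl _ _)) // eq_row_base.
- by rewrite (submx_trans (submxMl _ _)) // eq_row_base.
- by rewrite -mulmxA BT mulmxA aT mulmxBl !scalemxAl.
- by rewrite -mulmxA BT mulmxA bT mulmxDl !scalemxAl.
Qed.

(** * Inner product and the matrix J *)

Section Form.
Variable R : realType.

Lemma dotvE m (x y : 'cV[R]_m) : dotv x y = (x^T *m y) 0 0.
Proof. by rewrite mxE; apply: eq_bigr => k _; rewrite mxE. Qed.

Lemma dotvC m (x y : 'cV[R]_m) : dotv x y = dotv y x.
Proof. by apply: eq_bigr => k _; rewrite mulrC. Qed.

Lemma dotvDr m (x y z : 'cV[R]_m) : dotv x (y + z) = dotv x y + dotv x z.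
Proof. by rewrite !dotvE mulmxDr mxE. Qed.

Lemma dotvZr m (c : R) (x y : 'cV[R]_m) : dotv x (c *: y) = c * dotv x y.
Proof. by rewrite !dotvE -scalemxAr mxE. Qed.

Lemma dotvZl m (c : R) (x y : 'cV[R]_m) : dotv (c *: x) y = c * dotv x y.
Proof. by rewrite dotvC dotvZr dotvC. Qed.

Lemma dotv_adj m p (M : 'M[R]_(m, p)) (x : 'cV[R]_p) (y : 'cV[R]_m) :
  dotv (M *m x) y = dotv x (M^T *m y).
Proof. by rewrite !dotvE trmx_mul mulmxA. Qed.

Lemma dotv_col m p (x y : 'cV[R]_m) (x' y' : 'cV[R]_p) :
  dotv (col_mx x x') (col_mx y y') = dotv x y + dotv x' y'.
Proof. by rewrite !dotvE tr_col_mx mul_row_col mxE. Qed.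

Section J.
Variable n : nat.
Local Notation J := (@Jmx R n).

Lemma tr_Jmx : J^T = - J.
Proof.
rewrite tr_block_mx opp_block_mx !trmx0 trmx1 linearN /= trmx1 opprK.
by rewrite !oppr0.
Qed.

Lemma mul_JmxJmx : J *m J = - 1%:M.
Proof.
rewrite mulmx_block !mulmx0 !mul0mx !add0r !addr0 mul1mx mulmx1.
by rewrite (scalar_mx_block n n 1) opp_block_mx !oppr0.
Qed.
End J.
End Form.

(** * Symplectic frames and existence of the Williamson form *)

Section Frame.
Variables (R : realType) (n : nat).
Local Notation J := (@Jmx R n).
Implicit Types A : 'M[R]_(n + n).

(** A partial Williamson basis: the l-th columns of [U] and [V] form a normalized symplectic
    eigenvector pair for [d 0 l], and distinct pairs are J-orthogonal. *)
Definition sympl_frame A k (U V : 'M[R]_(n + n, k)) (d : 'rV[R]_k) : Prop :=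
  [/\ forall l, 0 < d 0 l,
      [/\ U^T *m J *m U = 0, V^T *m J *m V = 0 & U^T *m J *m V = 1%:M],
      A *m U = J *m V *m diag_mx d &
      A *m V = - (J *m U *m diag_mx d)].

Lemma Jmx_unit : J \in unitmx.
Proof.
by case: (@mulmx1_unit _ _ J (- J)) => //; rewrite mulmxN mul_JmxJmx opprK.
Qed.

Lemma posdef_unit A : posdefmx A -> A \in unitmx.
Proof.
move=> [_ pA]; rewrite -unitmx_tr -row_free_unit; apply/inj_row_free => x xA.
apply: contraTeq isT => x0; have := pA x^T; rewrite trmx_eq0 => /(_ x0).
by rewrite -(trmxK A) -trmx_mul xA trmx0 dotvE mulmx0 mxE ltxx.
Qed.

Lemma dotv_skewJ (x : 'cV[R]_(n + n)) : dotv x (J *m x) = 0.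
Proof.
have : dotv x (J *m x) = - dotv x (J *m x).
  rewrite {1}dotvC dotv_adj tr_Jmx !dotvE mulNmx mulmxN mxE; congr (- _).
lra.
Qed.

Lemma dotv_ge0 A (x : 'cV[R]_(n + n)) : posdefmx A -> 0 <= dotv x (A *m x).
Proof.
move=> [_ pA]; have [->|x0] := eqVneq x 0; last exact/ltW/pA.
by rewrite mulmx0 dotvE mulmx0 mxE.
Qed.

(** Since d <u, Jv> = <u, Au> > 0, both vectors can be divided by the square root of <u, Jv>. *)
Lemma sympl_eigenpair_normalize A d u v : posdefmx A -> 0 < d -> u != 0 ->
  A *m u = d *: (J *m v) -> A *m v = - d *: (J *m u) ->
  exists c : R, normalized_sympl_eigenpair A d (c *: u) (c *: v).
Proof.
move=> pA d0 u0 Au Av.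
have v0 : v != 0.
  apply: contra_neq u0 => v0; move: Au; rewrite v0 !mulmx0 scaler0 => Au.
  by rewrite -[u](mulKmx (posdef_unit pA)) Au mulmx0.
have uJv : 0 < dotv u (J *m v).
  by case: pA => _ /(_ _ u0); rewrite Au dotvZr pmulr_rgt0.
pose s := Num.sqrt (dotv u (J *m v)).
have s0 : 0 < s by rewrite sqrtr_gt0.
exists s^-1; split; last first.
  rewrite -scalemxAr dotvZr dotvZl -[dotv u _]sqr_sqrtr ?ltW // -/s.
  by field; rewrite gt_eqF.
split; rewrite ?scaler_eq0 ?negb_or ?u0 ?v0 ?invr_eq0 ?gt_eqF //.
  by rewrite -!scalemxAr Au !scalerA mulrC.
by rewrite -!scalemxAr Av !scalerA mulrC.
Qed.

(* The new pair comes from a complex eigenvector u + iv of A^-1 J on the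
   J-orthogonal complement of the frame, an invariant subspace of dimension
   2(n - k) > 0.  The eigenvalue p + iq is purely imaginary because A^-1 J is
   skew for the inner product defined by A. *)
Lemma sympl_frame_ext A k (U V : 'M[R]_(n + n, k)) d : posdefmx A ->
  (k < n)%N -> sympl_frame A U V d ->
  exists (U' V' : 'M[R]_(n + n, k + 1)) d', sympl_frame A U' V' d'.
Proof.
move=> pA kn [d0 [UU VV UV] AU AV].
have uA := posdef_unit pA.
pose W := kermx (J *m row_mx U V).
have rW : (0 < \rank W)%N.
  rewrite mxrank_ker subn_gt0; apply: leq_ltn_trans (rank_leq_col _) _.
  by rewrite -addnS leq_add // ltnW.
have ker (x : 'rV_(n + n)) : (x <= W)%MS -> x *m J *m U = 0 /\ x *m J *m V = 0.
  by move/sub_kermxP; rewrite mulmxA mul_mx_row -row_mx0 => /eq_row_mx.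
have subW (X : 'M_(n + n)) : X *m (J *m row_mx U V) = 0 -> (X <= W)%MS.
  by move/sub_kermxP.
have WJ : W *m (J *m row_mx U V) = 0 by exact: mulmx_ker.
clearbody W.
have [Di DDi] : exists Di : 'M[R]_k, diag_mx d *m Di = 1%:M.
  exists (diag_mx (map_mx GRing.inv d)); rewrite mulmx_diag -diag_const_mx.
  by congr diag_mx; apply/rowP => l; rewrite !mxE divff ?gt_eqF.
have JU : J *m U = - (A *m V *m Di).
  by rewrite AV mulNmx opprK -(mulmxA _ (diag_mx d)) DDi mulmx1.
have JV : J *m V = A *m U *m Di.
  by rewrite AU -(mulmxA _ (diag_mx d)) DDi mulmx1.
(* The transpose of A^-1 J, because row vectors are acted on from the right. *)
pose T := - (J *m invmx A).
(* By [JU] and [JV], A^-1 J maps the span of the frame to itself, so [T] preserves the complement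
   [W]. *)
have sW : stablemx W T.
  move: WJ; rewrite !mul_mx_row -row_mx0 => /eq_row_mx[].
  rewrite !mulmxA => WU WV.
  apply: subW; rewrite !mul_mx_row {1}JU JV /T.
  rewrite !mulmxN !mulNmx opprK -!mulmxA !(mulmxA (invmx A)) mulVmx // !mul1mx.
  by rewrite !(mulmxA J) !(mulmxA W) WU WV !mul0mx oppr0 row_mx0.
have [a [b [p [q [ab aW bW aT bT]]]]] := real_eigenpair_stable rW sW.
pose u := a^T; pose v := b^T.
have TT : A *m T^T = J.
  have [tA _] := pA.
  by rewrite linearN /= trmx_mul trmx_inv tA tr_Jmx !mulmxN opprK mulmxA
    mulmxV // mul1mx.
have Ju : J *m u = p *: (A *m u) - q *: (A *m v).
  have Tu : T^T *m u = p *: u - q *: v by rewrite -trmx_mul aT linearB !linearZ.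
  by rewrite -TT -mulmxA Tu mulmxBr -!scalemxAr.
have Jv : J *m v = q *: (A *m u) + p *: (A *m v).
  have Tv : T^T *m v = q *: u + p *: v by rewrite -trmx_mul bT linearD !linearZ.
  by rewrite -TT -mulmxA Tv mulmxDr -!scalemxAr.
have [c [x [y [c0 x0 Jx Jy [xW yW]]]]] : exists c (x y : 'cV[R]_(n + n)),
   [/\ 0 < c, x != 0, A *m x = c *: (J *m y), A *m y = - c *: (J *m x) &
     (x^T <= W)%MS /\ (y^T <= W)%MS].
  have uv0 : (u != 0) || (v != 0) by rewrite !trmx_eq0.
  (* Expanding <u, Ju> = 0 and <v, Jv> = 0 and adding cancels the [q] terms, leaving p (<u, Au> +
     <v, Av>) = 0. *)
  have p0 : p = 0.
    have Avu : dotv v (A *m u) = dotv u (A *m v).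
      by case: pA => tA _; rewrite dotvC dotv_adj tA.
    have := dotv_skewJ u; have := dotv_skewJ v.
    rewrite Ju Jv !dotvDr -!scaleNr !dotvZr Avu => e1 e2.
    have /eqP : p * (dotv u (A *m u) + dotv v (A *m v)) = 0 by lra.
    rewrite mulf_eq0 => /orP[/eqP //|].
    have := dotv_ge0 u pA; have := dotv_ge0 v pA; case: pA => _ pA'.
    by case/orP: uv0 => /pA'; lra.
  move: Ju Jv; rewrite p0 !scale0r sub0r addr0 => Ju Jv.
  have injJ (z : 'cV_(n + n)) : J *m z = 0 -> z = 0.
    by move=> Jz; rewrite -[z](mulKmx Jmx_unit) Jz mulmx0.
  have q0 : q != 0.
    apply: contraTneq uv0 => q0; move: Ju Jv.
    by rewrite q0 !scale0r oppr0 => /injJ -> /injJ ->; rewrite eqxx.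
  have u0 : u != 0.
    apply: contraTneq uv0 => u0; move: Jv; rewrite u0 mulmx0 scaler0.
    by move=> /injJ ->; rewrite eqxx.
  have v0 : v != 0.
    apply: contraTneq uv0 => v0; move: Ju; rewrite v0 mulmx0 scaler0 oppr0.
    by move=> /injJ ->; rewrite eqxx.
  (* The symplectic eigenvalue must be positive: it is 1/q for (u, v), or -1/q for the exchanged
     pair (v, u). *)
  have [qpos|qneg] : 0 < q \/ 0 < - q by rewrite oppr_gt0; case: ltgtP q0; auto.
    exists q^-1, u, v; split; rewrite ?invr_gt0 // ?trmxK //.
      by rewrite Jv scalerA mulVf // scale1r.
    by rewrite Ju scaleNr scalerN opprK scalerA mulVf // scale1r.
  exists (- q)^-1, v, u; split; rewrite ?invr_gt0 // ?trmxK //.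
    by rewrite Ju -scaleNr scalerA mulVf ?oppr_eq0 // scale1r.
  by rewrite Jv invrN opprK scalerA mulVf // scale1r.
have [e [[u0 v0 Au Av] uv]] := sympl_eigenpair_normalize pA c0 x0 Jx Jy.
set u' := e *: x in u0 v0 Au Av uv; set v' := e *: y in u0 v0 Au Av uv.
exists (row_mx U u'), (row_mx V v'), (row_mx d (const_mx c)).
rewrite -/u' -/v' in u0 v0 Au Av uv.
have [kuU kuV] : u'^T *m J *m U = 0 /\ u'^T *m J *m V = 0.
  by apply: ker; rewrite linearZ scalemx_sub.
have [kvU kvV] : v'^T *m J *m U = 0 /\ v'^T *m J *m V = 0.
  by apply: ker; rewrite linearZ scalemx_sub.
have flip m1 m2 (X : 'M_(n + n, m1)) (Y : 'M_(n + n, m2)) :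
    X^T *m J *m Y = - (Y^T *m J *m X)^T.
  by rewrite !trmx_mul trmxK tr_Jmx mulNmx mulmxN opprK mulmxA.
have uJu (z : 'cV_(n + n)) : z^T *m J *m z = 0.
  by apply/matrixP => r s; rewrite !ord1 -mulmxA -dotvE dotv_skewJ mxE.
split.
- move=> l; rewrite -(splitK l); case: (split l) => r /=.
    by rewrite row_mxEl.
  by rewrite row_mxEr mxE.
- split; rewrite tr_row_mx mul_col_mx mul_col_row.
  + by rewrite UU kuU uJu flip kuU trmx0 oppr0 block_mx0.
  + by rewrite VV kvV uJu flip kvV trmx0 oppr0 block_mx0.
  + rewrite UV kuV flip kvU trmx0 oppr0 [u'^T *m J *m v'](_ : _ = 1%:M).
      by rewrite -scalar_mx_block.
    by apply/matrixP => r s; rewrite !ord1 -mulmxA -dotvE uv mxE.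
- rewrite !mul_mx_row diag_mx_row mul_row_block !mulmx0 addr0 add0r AU Au.
  by rewrite diag_const_mx mul_mx_scalar.
- rewrite !mul_mx_row diag_mx_row mul_row_block !mulmx0 addr0 add0r AV Av.
  by rewrite diag_const_mx mul_mx_scalar opp_row_mx scaleNr.
Qed.

Lemma sympl_frame_exists A : posdefmx A ->
  exists (U V : 'M[R]_(n + n, n)) d, sympl_frame A U V d.
Proof.
move=> pA.
suff: forall k, (k <= n)%N ->
    exists (U V : 'M[R]_(n + n, k)) d, sympl_frame A U V d.
  by apply.
elim=> [_|k IHk kn].
  exists 0, 0, 0; split; rewrite ?mulmx0 ?mul0mx ?oppr0 //; first by case.
  by split; apply/matrixP; case.
have [U [V [d h]]] := IHk (ltnW kn).
by rewrite -addn1; apply: sympl_frame_ext h.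
Qed.

(** Lets the pairs be reordered so that [d] becomes nondecreasing, as [williamson_diag] demands. *)
Lemma sympl_frame_perm A k (U V : 'M[R]_(n + n, k)) d (s : 'S_k) :
  sympl_frame A U V d ->
  sympl_frame A (col_perm s U) (col_perm s V) (col_perm s d).
Proof.
move=> [d0 [UU VV UV] AU AV].
have colE m (X : 'M[R]_(m, k)) : col_perm s X = X *m (perm_mx s)^T.
  by rewrite col_permE tr_perm_mx.
have PP : perm_mx s *m (perm_mx s)^T = 1%:M :> 'M[R]_k.
  by rewrite tr_perm_mx -perm_mxM mulgV perm_mx1.
have dE : (perm_mx s)^T *m diag_mx (col_perm s d) = diag_mx d *m (perm_mx s)^T.
  apply/matrixP => a b; rewrite tr_perm_mx mul_diag_mx mul_mx_diag !mxE.
  by case: eqP => [<-|_]; rewrite ?mulr0 ?mul0r // permKV mulr1 mul1r.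
split.
- by move=> l; rewrite mxE.
- have conjE (X Y : 'M_(n + n, k)) : (col_perm s X)^T *m J *m col_perm s Y =
      perm_mx s *m (X^T *m J *m Y) *m (perm_mx s)^T.
    by rewrite !colE trmx_mul trmxK !mulmxA.
  by rewrite !conjE UU VV UV mulmx0 mul0mx mulmx1.
- by rewrite (colE _ U) (colE _ V) mulmxA AU -!mulmxA dE.
- by rewrite (colE _ U) (colE _ V) mulmxA AV mulNmx -!mulmxA dE.
Qed.

Lemma sort_perm k (d : 'rV[R]_k) : exists s : 'S_k,
  forall a b : 'I_k, (a <= b)%N -> d 0 (s a) <= d 0 (s b).
Proof.
pose t := [tuple d 0 l | l < k].
have /tuple_permP[s sE] : perm_eq (sort <=%R t) t by rewrite perm_sort.
exists s => a b ab.
have nE (c : 'I_k) : d 0 (s c) = nth 0 (sort <=%R t) c.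
  by rewrite sE -tnth_nth tnth_mktuple tnth_mktuple.
have szt : size (sort <=%R t) = k by rewrite size_sort size_tuple.
rewrite !nE; apply: (sorted_leq_nth le_trans) => //.
- by apply: sort_sorted; exact: le_total.
- by rewrite inE szt.
- by rewrite inE szt.
Qed.

(** The columns of a sorted full frame form M. The frame relations give M^T J M = J, and
    substituting A U = J V D, A V = - J U D reduces M^T A M to the same products. *)
Lemma williamson A : posdefmx A -> exists d, williamson_diag A d.
Proof.
move=> pA; have [U [V [d h]]] := sympl_frame_exists pA.
have [s ds] := sort_perm d.
have [d0 [UU VV UV] AU AV] := sympl_frame_perm s h.
set U' := col_perm s U in UU UV AU AV; set V' := col_perm s V in VV UV AU AV.
set d' := col_perm s d in d0 AU AV.
have VU : V'^T *m J *m U' = - 1%:M.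
  have := congr1 (fun X => - X^T) UV.
  by rewrite /= !trmx_mul trmxK tr_Jmx mulNmx mulmxN opprK trmx1 mulmxA.
exists d'; split => //; first by move=> a b ab; rewrite !mxE; exact: ds.
exists (row_mx U' V').
  by rewrite /symplecticmx tr_row_mx mul_col_mx mul_col_row UU UV VU VV.
rewrite tr_row_mx mul_col_mx mul_col_row -!mulmxA AU AV !mulmxN !mulmxA.
by rewrite UU UV VU VV !mul0mx oppr0 !mul1mx mulNmx opprK mul1mx.
Qed.

Lemma sympl_eigenvalueP A : posdefmx A ->
  williamson_diag A (\row_k sympl_eigenvalue A k).
Proof.
move=> /williamson [d hd].
have := xgetPex 0 (ex_intro _ d hd).
by congr (williamson_diag _ _); apply/rowP => k; rewrite mxE.
Qed.
End Frame.

(** The dimension count: fewer than N functionals, stacked as rows, have rank below N. *)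
Lemma common_kernel (F : fieldType) (N : nat) (I : finType)
    (phi : I -> 'rV[F]_N) :
  (#|I| < N)%N -> exists2 w : 'cV[F]_N, w != 0 & forall i, phi i *m w = 0.
Proof.
move=> cI; pose P := \matrix_(i < #|I|) phi (enum_val i).
have : kermx P^T != 0.
  rewrite kermx_eq0 /row_free neq_ltn; apply/orP; left.
  by apply: leq_ltn_trans cI; apply: rank_leq_col.
case/rowV0Pn => w /sub_kermxP wP w0.
exists w^T; first by rewrite trmx_eq0.
move=> i; apply: trmx_inj; rewrite trmx_mul trmxK trmx0.
move/rowP: wP => /(_ (enum_rank i)); rewrite !mxE => wP.
apply/colP => k; rewrite !ord1 !mxE -[RHS]wP; apply: eq_bigr => l _.
by rewrite !mxE enum_rankK.
Qed.

(** * The form q_{A,t}, here [pencil A t]: diagonalization and sign *)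

Section Pencil.
Variables (R : realType) (n : nat).
Local Notation J := (@Jmx R n).
Implicit Types A M : 'M[R]_(n + n).

Definition pencil A t (u v : 'cV[R]_(n + n)) : R :=
  dotv u (A *m u) + dotv v (A *m v) - 2 * t * dotv u (J *m v).

Lemma mul_Jmx_col p (x y : 'M[R]_(n, p)) : J *m col_mx x y = col_mx y (- x).
Proof. by rewrite mul_block_col !mul0mx mul1mx mulNmx mul1mx add0r addr0. Qed.

Lemma dotv_diag (d : 'rV[R]_n) (x : 'cV[R]_n) :
  dotv x (diag_mx d *m x) = \sum_k d 0 k * x k 0 ^+ 2.
Proof. by apply: eq_bigr => k _; rewrite mul_diag_mx mxE; ring. Qed.

(** For each k the form splits into d (x1^2 + y2^2) - 2 t x1 y2 and d (x2^2 + y1^2) + 2 t x2 y1,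
    each diagonalized by sum and difference. *)
Lemma pencil_frame A M d t (x1 x2 y1 y2 : 'cV[R]_n) :
  symplecticmx M -> M^T *m A *m M = block_mx (diag_mx d) 0 0 (diag_mx d) ->
  pencil A t (M *m col_mx x1 x2) (M *m col_mx y1 y2) =
  \sum_k ((d 0 k - t) / 2 *
            ((x1 k 0 + y2 k 0) ^+ 2 + (x2 k 0 - y1 k 0) ^+ 2) +
          (d 0 k + t) / 2 *
            ((x1 k 0 - y2 k 0) ^+ 2 + (x2 k 0 + y1 k 0) ^+ 2)).
Proof.
move=> sM dM; rewrite /pencil !dotv_adj !mulmxA dM sM.
rewrite mul_Jmx_col !mul_block_col.
rewrite !mul0mx !add0r !addr0 !dotv_col !dotv_diag /dotv.
rewrite -!big_split mulr_sumr -sumrB /=; apply: eq_bigr => k _.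
by rewrite mxE; field.
Qed.

Lemma symplectic_unit M : symplecticmx M -> M \in unitmx.
Proof.
move=> sM; have := Jmx_unit R n; rewrite -sM !unitmx_mul.
by case/andP.
Qed.

(** The possibly negative coefficients d_k - d_i, k < i, multiply squares that vanish by hypothesis,
    so every term is nonnegative; a zero sum forces each term to be zero. *)
Lemma pencil_lower A d (i : 'I_n) M (x1 x2 y1 y2 : 'cV[R]_n)
    (u := M *m col_mx x1 x2) (v := M *m col_mx y1 y2) :
  symplecticmx M -> M^T *m A *m M = block_mx (diag_mx d) 0 0 (diag_mx d) ->
  (forall k, 0 < d 0 k) -> (forall k l : 'I_n, (k <= l)%N -> d 0 k <= d 0 l) ->
  (forall k : 'I_n, (k < i)%N -> x1 k 0 + y2 k 0 = 0 /\ x2 k 0 - y1 k 0 = 0) ->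
  0 <= pencil A (d 0 i) u v /\
  (pencil A (d 0 i) u v = 0 ->
     A *m u = d 0 i *: (J *m v) /\ A *m v = - d 0 i *: (J *m u)).
Proof.
move=> sM dM d0 ds xy; rewrite (pencil_frame _ _ _ _ _ sM dM); set t := d 0 i.
have pos_minus (k : 'I_n) :
    0 <= (d 0 k - t) / 2 * ((x1 k 0 + y2 k 0) ^+ 2 + (x2 k 0 - y1 k 0) ^+ 2).
  have [ki|ik] := ltnP k i.
    by have [-> ->] := xy _ ki; rewrite expr0n addr0 mulr0.
  by rewrite mulr_ge0 ?addr_ge0 ?sqr_ge0 // divr_ge0 // subr_ge0 ds.
have pos_plus (k : 'I_n) :
    0 <= (d 0 k + t) / 2 * ((x1 k 0 - y2 k 0) ^+ 2 + (x2 k 0 + y1 k 0) ^+ 2).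
  by rewrite mulr_ge0 ?addr_ge0 ?sqr_ge0 // divr_ge0 // addr_ge0 //;
    apply/ltW/d0.
split; first by apply: sumr_ge0 => k _; rewrite addr_ge0.
move=> /eqP; rewrite psumr_eq0 => [/allP q0|k _]; last by rewrite addr_ge0.
(* As d_k + t > 0, the squares it multiplies vanish. Then either d_k = t, or the other two squares
   vanish too and all four coordinates are 0. *)
have eqs (k : 'I_n) : [/\ x1 k 0 = y2 k 0, x2 k 0 = - y1 k 0,
    d 0 k * x1 k 0 = t * y2 k 0 & d 0 k * x2 k 0 = - (t * y1 k 0)].
  move: (q0 k (mem_index_enum k)); rewrite /= paddr_eq0 // => /andP[].
  rewrite !mulf_eq0 !invr_eq0 pnatr_eq0 !orbF.
  rewrite (gt_eqF (addr_gt0 (d0 k) (d0 i))) /=.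
  rewrite !(paddr_eq0 (sqr_ge0 _) (sqr_ge0 _)) !sqrf_eq0.
  move=> m0 /andP[/eqP x1y2 /eqP x2y1].
  have x1E : x1 k 0 = y2 k 0 by lra.
  have x2E : x2 k 0 = - y1 k 0 by lra.
  move: m0 => /orP[/eqP dt|/andP[/eqP m1 /eqP m2]].
    have -> : d 0 k = t by lra.
    by rewrite x1E x2E mulrN.
  have -> : x1 k 0 = 0 by lra.
  have -> : y2 k 0 = 0 by lra.
  have -> : x2 k 0 = 0 by lra.
  have -> : y1 k 0 = 0 by lra.
  by rewrite !mulr0 oppr0.
have uM : M^T \in unitmx by rewrite unitmx_tr symplectic_unit.
(* Multiplication by M^T turns the eigenvector equations into coordinatewise ones, which [eqs]
   solves. *)
by split; apply: (can_inj (mulKmx uM)); rewrite -!scalemxAr /u /v !mulmxA dM sM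
  mul_Jmx_col mul_block_col !mul0mx add0r addr0 scale_col_mx; congr col_mx;
  apply/colP => k; rewrite mul_diag_mx !mxE; have [? ? ? ?] := eqs k; nra.
Qed.

(** This choice of second vector kills the squares with coefficient d_k + t, leaving 2 (d_k - d_m)
    (w1^2 + w2^2), where only k <= m contributes. *)
Lemma pencil_upper A d (m : 'I_n) M (w1 w2 : 'cV[R]_n) :
  symplecticmx M -> M^T *m A *m M = block_mx (diag_mx d) 0 0 (diag_mx d) ->
  (forall k l : 'I_n, (k <= l)%N -> d 0 k <= d 0 l) ->
  (forall k : 'I_n, (m < k)%N -> w1 k 0 = 0 /\ w2 k 0 = 0) ->
  pencil A (d 0 m) (M *m col_mx w1 w2) (M *m col_mx (- w2) w1) <= 0.
Proof.
move=> sM dM ds w0; rewrite (pencil_frame _ _ _ _ _ sM dM).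
apply: sumr_le0 => k _; rewrite mxE subrr addrN expr0n /= addr0 mulr0 addr0.
have [km|mk] := leqP k m; last first.
  by have [-> ->] := w0 _ mk; rewrite !oppr0 !addr0 expr0n /= addr0 mulr0.
rewrite mulr_le0_ge0 ?addr_ge0 ?sqr_ge0 //.
by rewrite pmulr_lle0 ?invr_gt0 // subr_le0 ds.
Qed.

Lemma pencilD A B s t u v :
  pencil (A + B) (s + t) u v = pencil A s u v + pencil B t u v.
Proof. by rewrite /pencil !mulmxDl !dotvDr; ring. Qed.
End Pencil.

(* Indices in 'I_n start at 0: with i = i' + 1 and j = j' + 1, the condition
   i + j - 1 <= n reads i' + j' < n, and d_{i+j-1} has 0-based index i' + j'. *)
Theorem theorem1 (R : realType) (n : nat) (A B : 'M[R]_(n + n))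
    (hA : posdefmx A) (hB : posdefmx B) (i j : 'I_n) (hij : (i + j < n)%N) :
  sympl_eigenvalue (A + B) (Ordinal hij) =
    sympl_eigenvalue A i + sympl_eigenvalue B j
  <->
  exists u v : 'cV[R]_(n + n),
    [/\ normalized_sympl_eigenpair A (sympl_eigenvalue A i) u v,
        normalized_sympl_eigenpair B (sympl_eigenvalue B j) u v &
        normalized_sympl_eigenpair (A + B)
          (sympl_eigenvalue (A + B) (Ordinal hij)) u v].
Proof.
split=> [eqd|]; last first.
  (* Pairing (A + B) u with u and using <u, Jv> = 1 adds the eigenvalues. *)
  move=> [u [v [[[_ _ Au _] uJv] [[_ _ Bu _] _] [[_ _ ABu _] _]]]].
  have := congr1 (dotv u) ABu.
  by rewrite mulmxDl Au Bu dotvDr !dotvZr uJv !mulr1.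
have hAB : posdefmx (A + B).
  case: hA hB => tA pA [tB pB]; split; first by rewrite linearD /= tA tB.
  by move=> x x0; rewrite mulmxDl dotvDr addr_gt0 ?pA ?pB.
have [A0 As [M sM dM]] := sympl_eigenvalueP hA.
have [B0 Bs [N sN dN]] := sympl_eigenvalueP hB.
have [_ ABs [P sP dP]] := sympl_eigenvalueP hAB.
pose m := Ordinal hij; rewrite -/m in eqd *.
(* The common pair is sought as (u, v) = (P w, -P J w).  X L and Y L map w to
   the L-coordinates of u and v, and the functionals phi ask that the
   coordinates of index below i (in the basis M) or below j (in N) carrying the
   coefficient d_k - t vanish, and that w involve only the indices at most m:
   2 (n - 1) conditions in total. *)
pose X (L : 'M[R]_(n + n)) := invmx L *m P.
pose Y (L : 'M[R]_(n + n)) := - (invmx L *m P *m Jmx).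
pose Z (L : 'M[R]_(n + n)) (b : bool) : 'M[R]_(n, n + n) :=
  if b then usubmx (X L) + dsubmx (Y L) else dsubmx (X L) - usubmx (Y L).
pose W (b : bool) : 'M[R]_(n, n + n) := if b then usubmx 1%:M else dsubmx 1%:M.
pose phi (c : ('I_i + 'I_j + 'I_(n - m.+1)) * bool) : 'rV[R]_(n + n) :=
  match c.1 with
  | inl (inl k) => row (widen_ord (ltnW (ltn_ord i)) k) (Z M c.2)
  | inl (inr k) => row (widen_ord (ltnW (ltn_ord j)) k) (Z N c.2)
  | inr k => row (rev_ord (widen_ord (leq_subr _ _) k)) (W c.2)
  end.
have [|w w0 phiw] := common_kernel phi.
  by rewrite card_prod !card_sum !card_ord card_bool /=; lia.
pose u := P *m w; pose v := - (P *m Jmx *m w).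
have frameE (L : 'M[R]_(n + n)) (x : 'cV[R]_(n + n)) : symplecticmx L ->
    x = L *m col_mx (usubmx (invmx L *m x)) (dsubmx (invmx L *m x)).
  by move=> sL; rewrite vsubmxK mulKVmx ?symplectic_unit.
have Zk (L : 'M[R]_(n + n)) k :
    (forall b, row k (Z L b) *m w = 0) ->
    (usubmx (invmx L *m u)) k 0 + (dsubmx (invmx L *m v)) k 0 = 0 /\
    (dsubmx (invmx L *m u)) k 0 - (usubmx (invmx L *m v)) k 0 = 0.
  move=> Z0; have -> : invmx L *m u = X L *m w by rewrite mulmxA.
  have -> : invmx L *m v = Y L *m w by rewrite mulmxN mulNmx !mulmxA.
  split.
    move: (Z0 true); rewrite -row_mul mulmxDl !mul_usub_mx !mul_dsub_mx.
    by move=> /rowP/(_ 0); rewrite !mxE.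
  move: (Z0 false); rewrite -row_mul mulmxBl !mul_usub_mx !mul_dsub_mx.
  by move=> /rowP/(_ 0); rewrite !mxE.
have [qA0 qA] : 0 <= pencil A (sympl_eigenvalue A i) u v /\
    (pencil A (sympl_eigenvalue A i) u v = 0 ->
      A *m u = sympl_eigenvalue A i *: (Jmx *m v) /\
      A *m v = - sympl_eigenvalue A i *: (Jmx *m u)).
  rewrite (frameE M u sM) (frameE M v sM).
  have := pencil_lower (i := i) sM dM A0 As; rewrite mxE; apply=> k ki.
  apply: Zk => b; have := phiw (inl (inl (Ordinal ki)), b).
  by rewrite /phi /=; congr (row _ _ *m _ = _); apply: val_inj.
have [qB0 qB] : 0 <= pencil B (sympl_eigenvalue B j) u v /\
    (pencil B (sympl_eigenvalue B j) u v = 0 ->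
      B *m u = sympl_eigenvalue B j *: (Jmx *m v) /\
      B *m v = - sympl_eigenvalue B j *: (Jmx *m u)).
  rewrite (frameE N u sN) (frameE N v sN).
  have := pencil_lower (i := j) sN dN B0 Bs; rewrite mxE; apply=> k kj.
  apply: Zk => b; have := phiw (inl (inr (Ordinal kj)), b).
  by rewrite /phi /=; congr (row _ _ *m _ = _); apply: val_inj.
have qAB : pencil (A + B) (sympl_eigenvalue (A + B) m) u v <= 0.
  have vE : v = P *m col_mx (- dsubmx w) (usubmx w).
    rewrite /v -mulmxA -mulmxN -[in LHS](vsubmxK w) mul_Jmx_col.
    by rewrite opp_col_mx opprK.
  rewrite vE /u -[in X in pencil _ _ X _](vsubmxK w).
  have := pencil_upper (m := m) sP dP ABs; rewrite mxE; apply=> k mk.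
  (* An index k > m is the image under [rev_ord] of n - k - 1, which lies in the range of the third
     family of [phi]. *)
  have lk : (n - k.+1 < n - m.+1)%N by have := ltn_ord k; move: mk => /=; lia.
  have Wk b : row k (W b) *m w = 0.
    have := phiw (inr (Ordinal lk), b); rewrite /phi /=.
    congr (row _ _ *m _ = _); apply: val_inj => /=.
    by have := ltn_ord k; lia.
  split.
    move: (Wk true); rewrite -row_mul mul_usub_mx mul1mx => /rowP/(_ 0).
    by rewrite !mxE.
  move: (Wk false); rewrite -row_mul mul_dsub_mx mul1mx => /rowP/(_ 0).
  by rewrite !mxE.
(* The assumed equality enters here: two nonnegative values have a nonpositive sum, so both are
   zero. *)
move: qAB; rewrite eqd pencilD => qAB.
have [Au Av] := qA ltac:(lra).
have [Bu Bv] := qB ltac:(lra).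
have u0 : u != 0.
  apply: contra_neq w0 => u0.
  by rewrite -[w](mulKmx (symplectic_unit sP)) -/u u0 mulmx0.
have dA0 : 0 < sympl_eigenvalue A i by have := A0 i; rewrite mxE.
have [c [[cu0 cv0 cAu cAv] cuv]] := sympl_eigenpair_normalize hA dA0 u0 Au Av.
(* The normalization <u, Jv> = 1 does not involve the matrix, so the scalar [c] found for [A] also
   serves [B] and [A + B]. *)
have cB : B *m (c *: u) = sympl_eigenvalue B j *: (Jmx *m (c *: v)) /\
    B *m (c *: v) = - sympl_eigenvalue B j *: (Jmx *m (c *: u)).
  by rewrite -!scalemxAr Bu Bv !scalerA ![c * _]mulrC.
case: cB => cBu cBv.
exists (c *: u), (c *: v); split; split=> //; split=> //.
  by rewrite mulmxDl cAu cBu -scalerDl.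
by rewrite mulmxDl cAv cBv -scalerDl -opprD.
Qed.
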